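(* Let $n\ge1$ and let $\lambda$ be a first layer weight in type $A_n$, of co-length $N$ and with aggregate vector $\mathbf{a}_\lambda=(\mathbf{a}_\lambda(1),\dots,\mathbf{a}_\lambda(N))$. Then $$c_\lambda(t)=t^{\mathrm{ht}(\lambda)}\,(1-t^{\mathbf{a}_\lambda}),\qquad\text{where } (1-t^{\mathbf{a}_\lambda}):=\prod_{j=1}^{N}\bigl(1-t^{\min\{0,\mathbf{a}_\lambda(j)\}}\bigr)$$ (the empty product being $1$).
   Context: Type $A_n$ conventions: $\varepsilon_1,\dots,\varepsilon_{n+1}$ is the standard basis of $\mathbb{R}^{n+1}$ with its canonical scalar product $(\cdot,\cdot)$; positive roots $R^+=\{\varepsilon_i-\varepsilon_j\}_{i<j}$. The root lattice is $Q=\{\lambda\in\mathbb{Z}^{n+1}:\sum_i\lambda_i=0\}$; ''weight'' means element of $Q$. The height of a weight is $\mathrm{ht}(\lambda)=(\lambda,\rho)$ with $\rho=\frac12\sum_{\alpha\in R^+}\alpha$. Fourier coefficients: let $e^\lambda$ ($\lambda\in Q$) be the characters of the compact torus $T$ with character lattice $Q$, and $ds$ the Haar measure of volume one on $T$. Put $C(t)=\prod_{\alpha\in R^+}\frac{1-e^\alpha}{1-te^\alpha}$ (for $|t|$ small, a continuous function on $T$; equivalently expand in powers of $t$ for formal $t$). Then $c_\lambda(t)=\int_T C(t)\,e^{-\lambda}\,ds$, which is an element of $\mathbb{Q}(t)$. A weight is first layer if its smallest coordinate is $-1$ or if it is $0$. Its co-length $N=\ell^*(\lambda)$ is the number of its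 negative coordinates (all equal to $-1$; $N=0$ for $\lambda=0$). If $\lambda_{i_1}=\cdots=\lambda_{i_N}=-1$, $i_1<\cdots<i_N$, are the negative coordinates, the aggregate vector has entries $\mathbf{a}_\lambda(j)=\sum_{k=i_j}^{n+1}\lambda_k$, $1\le j\le N$ ($\mathbf a_0$ is empty). *)

(* Defs.v *)
From HB Require Import structures.
From mathcomp Require Import all_boot all_order all_algebra.
From mathcomp Require Import all_classical all_reals all_analysis.
From mathcomp Require Import complex.

Set Implicit Arguments.
Unset Strict Implicit.
Unset Printing Implicit Defensive.

Import Order.TTheory GRing.Theory Num.Theory.
Import numFieldNormedType.Exports.

Local Open Scope ring_scope.

(* Type A_n. Coordinates of Z^(n+1) are indexed from 0: eps_1, ..., eps_(n+1)
   are eps ord0, ..., eps ord_max. *)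
Section Weights.
Variable n : nat.
Implicit Types lambda : 'rV[int]_n.+1.

Definition eps (i : 'I_n.+1) : 'rV[int]_n.+1 := delta_mx 0 i.

Definition root_vec (i j : 'I_n.+1) : 'rV[int]_n.+1 := eps i - eps j.

Definition is_weight lambda : bool := \sum_i lambda 0 i == 0.

Definition dot (u v : 'rV[rat]_n.+1) : rat := \sum_i u 0 i * v 0 i.

Definition rho : 'rV[rat]_n.+1 :=
  2%:R^-1 *: \sum_(r : 'I_n.+1 * 'I_n.+1 | (r.1 < r.2)%N)
               map_mx intr (root_vec r.1 r.2).

Definition height lambda : rat := dot (map_mx intr lambda) rho.

Definition first_layer lambda : bool :=
  (lambda == 0) ||
  [exists i, lambda 0 i == -1] && [forall i, -1 <= lambda 0 i].

Definition negatives lambda : {set 'I_n.+1} := [set i | lambda 0 i < 0].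

Definition colength lambda : nat := #|negatives lambda|.

(* [enum_val j] is the (j+1)-st negative position, in increasing order. *)
Definition aggregate lambda (j : 'I_(colength lambda)) : int :=
  \sum_(k < n.+1 | (enum_val j <= k)%N) lambda 0 k.

End Weights.

Section Torus.
Variable R : realType.

(* The torus T with character lattice Q is (R/Z)^n, where Q has the basis
   eps_i - eps_(n+1), 1 <= i <= n, and the point theta is the one at which
   e^(eps_i - eps_(n+1)) takes the value exp(2 i pi theta_i). Points are given
   by real coordinates; the Haar measure is carried by the fundamental domain
   [0, 1]^n, where it is the Lebesgue measure. *)
Definition torus (n : nat) := n.-tuple (measurableTypeR R).

Definition torus_cons (n : nat) (x : measurableTypeR R * torus n) :
  torus n.+1 := [tuple of x.1 :: x.2].

Fact measurable_torus_cons n : measurable_fun setT (@torus_cons n).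
Proof. exact: (measurable_cons measurable_fst measurable_snd). Qed.

HB.instance Definition _ n :=
  isMeasurableFun.Build _ _ _ _ (@torus_cons n) (@measurable_torus_cons n).

Fixpoint haar (n : nat) : probability (torus n) R :=
  match n with
  | 0 => \d_([tuple] : torus 0)
  | m.+1 => distribution (uniform_prob (@ltr01 R) \x haar m)%E (@torus_cons m)
  end.

Definition torus_integral (n : nat) (f : torus n -> R[i]) : R[i] :=
  Complex (Rintegral (haar n) setT (fun theta => complex.Re (f theta)))
          (Rintegral (haar n) setT (fun theta => complex.Im (f theta))).

Definition expi (x : R) : R[i] := Complex (cos x) (sin x).

Definition torus_char (n : nat) (lambda : 'rV[int]_n.+1) (theta : torus n) :
    R[i] :=
  expi (2 * pi * \sum_(i < n)
          (lambda 0 (widen_ord (leqnSn n) i))%:~R * tnth theta i).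

Definition C_fun (n : nat) (t : R[i]) (theta : torus n) : R[i] :=
  \prod_(r : 'I_n.+1 * 'I_n.+1 | (r.1 < r.2)%N)
     ((1 - torus_char (root_vec r.1 r.2) theta) /
      (1 - t * torus_char (root_vec r.1 r.2) theta)).

Definition fourier_integral (n : nat) (lambda : 'rV[int]_n.+1) (t : R[i]) :
    R[i] :=
  torus_integral (fun theta : torus n =>
                    C_fun t theta * torus_char (- lambda) theta).

(* The element [c] of Q(t) is the Fourier coefficient c_lambda: the integral,
   as a function of the complex number t, |t| < 1, is the rational function [c].
   On T one has |e^alpha| = 1, so C(t) is continuous on T for such t. There is
   at most one such [c], see [fourier_coeff_unique]. *)
Definition is_fourier_coeff (n : nat) (lambda : 'rV[int]_n.+1)
    (c : {fraction {poly rat}}) : Prop :=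
  exists p q : {poly rat},
    [/\ q != 0, c = tofrac p / tofrac q &
        forall t : R[i], `|t| < 1 -> (map_poly ratr q).[t] != 0 ->
          fourier_integral lambda t
            = (map_poly ratr p).[t] / (map_poly ratr q).[t]].

End Torus.

(* The indeterminate of Q(t). *)
Definition tvar : {fraction {poly rat}} := tofrac 'X.

(* Heights of elements of Q are integers, so that [Num.floor (height lambda)]
   is the height as an exponent. *)
Lemma floor_height n (lambda : 'rV[int]_n.+1) :
  is_weight lambda -> (Num.floor (height lambda))%:~R = height lambda.
Proof.
move=> /eqP lam0; apply/eqP; rewrite -intrEfloor.
pose L : int := \sum_(r : 'I_n.+1 * 'I_n.+1 | (r.1 < r.2)%N) lambda 0 r.1.
pose M : int := \sum_(r : 'I_n.+1 * 'I_n.+1 | (r.1 < r.2)%N) lambda 0 r.2.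
have LM : L + M = 0.
  have tot : \sum_(r : 'I_n.+1 * 'I_n.+1) lambda 0 r.1 = 0.
    rewrite -(pair_bigA _ (fun i _ : 'I_n.+1 => lambda 0 i)) /=.
    by rewrite exchange_big /=; apply: big1 => j _.
  have dia : \sum_(r : 'I_n.+1 * 'I_n.+1 | r.1 == r.2) lambda 0 r.1 = 0.
    rewrite -(pair_big_dep xpredT (fun i j : 'I_n.+1 => i == j)
                 (fun i _ => lambda 0 i)) /=.
    rewrite -[RHS]lam0; apply: eq_bigr => i _.
    by rewrite (bigD1 i) //= big1 ?addr0 // => j /andP[/eqP -> /eqP].
  have -> : M = \sum_(r : 'I_n.+1 * 'I_n.+1 | (r.2 < r.1)%N) lambda 0 r.1.
    rewrite /M (reindex_inj (h := fun r : 'I_n.+1 * 'I_n.+1 => (r.2, r.1))) //.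
    by move=> [? ?] [? ?] /= [-> ->].
  rewrite -[RHS]tot [RHS](bigID (fun r : 'I_n.+1 * 'I_n.+1 => r.1 == r.2)) /= dia.
  rewrite add0r [RHS](bigID (fun r : 'I_n.+1 * 'I_n.+1 => (r.1 < r.2)%N)) /=.
  congr (_ + _); apply: eq_bigl => -[i j] /=; rewrite -val_eqE /=; by case: ltngtP.
suff -> : height lambda = L%:~R by exact: intr_int.
have -> : height lambda = 2%:R^-1 * (L - M)%:~R.
  rewrite /height /dot /rho.
  under eq_bigr => k _ do rewrite !mxE summxE mulrCA.
  rewrite -mulr_sumr; congr (_ * _).
  under eq_bigr => k _ do rewrite mulr_sumr.
  rewrite exchange_big /= /L /M -sumrB rmorph_sum /=.
  apply: eq_bigr => -[i j] /= _.
  rewrite (eq_bigr (fun k => (lambda 0 k)%:~R * (k == i)%:R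
                             - (lambda 0 k)%:~R * (k == j)%:R)); last first.
    move=> k _; rewrite !mxE /= rmorphB /= mulrBr.
    by case: (k == i); case: (k == j).
  rewrite sumrB rmorphB /=; congr (_ - _).
    rewrite (bigD1 i) //= eqxx mulr1 big1 ?addr0 // => k /negPf ->.
    by rewrite mulr0.
  rewrite (bigD1 j) //= eqxx mulr1 big1 ?addr0 // => k /negPf ->.
  by rewrite mulr0.
move/eqP: LM; rewrite addr_eq0 => /eqP LM.
have -> : L - M = L *+ 2 by rewrite LM mulr2n.
by rewrite rmorphMn /= -(mulr_natl L%:~R) mulKf.
Qed.

Lemma fourier_coeff_unique (R : realType) n (lambda : 'rV[int]_n.+1)
    (c d : {fraction {poly rat}}) :
  is_fourier_coeff R lambda c -> is_fourier_coeff R lambda d -> c = d.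
Proof.
move=> [p [q [q0 -> Hc]]] [p' [q' [q'0 -> Hd]]].
have ft0 (u : {poly rat}) : u != 0 -> tofrac u != 0 by rewrite tofrac_eq0.
apply/eqP; rewrite eqr_div ?ft0 // -!rmorphM /= -subr_eq0 -rmorphB /= tofrac_eq0.
apply/negPn/negP => h0.
pose h := (p * q' - p' * q) * (q * q').
have hn0 : h != 0 by rewrite !mulf_neq0.
pose s := [seq (m.+2%:R : rat)^-1 | m <- iota 0 (size h)].
have us : uniq s.
  rewrite map_inj_uniq ?iota_uniq // => a b /invr_inj /eqP.
  by rewrite eqr_nat => /eqP [].
have /(max_poly_roots hn0)/(_ us) : all (root h) s; last first.
  by rewrite size_map size_iota ltnn.
apply/allP => x /mapP [m _ ->] {x}; set x : rat := _^-1.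
pose t : R[i] := ratr x.
have t1 : `|t| < 1.
  rewrite /t -ratr_norm -(rmorph1 (ratr : rat -> R[i])) ltr_rat.
  by rewrite ger0_norm ?invr_ge0 ?ler0n // invf_lt1 ?ltr0n // ltr1n.
have ev (u : {poly rat}) : (map_poly ratr u).[t] = ratr u.[x] :> R[i].
  by rewrite horner_map.
rewrite /root /h !hornerE /=.
have [->|qx] := eqVneq q.[x] 0; first by rewrite !(mul0r, mulr0).
have [->|q'x] := eqVneq q'.[x] 0; first by rewrite !(mul0r, mulr0).
have := Hc t t1; have := Hd t t1; rewrite !ev !fmorph_eq0 qx q'x.
move=> /(_ isT) -> /(_ isT) /eqP.
rewrite eqr_div ?fmorph_eq0 // -!rmorphM /= (inj_eq (fmorph_inj _)) => /eqP ->.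
by rewrite subrr !mul0r.
Qed.

(* Main.v *)
(* Integrating out the first coordinate of the torus expands the factors
   (1 - z) / (1 - t z), z = e^(eps_1 - eps_j), j > 1, into power series; with h
   the coefficients of that series this gives
     c_lambda = sum over mu >= 0, |mu| = lambda_1, of (prod_j h(mu_j)) c_(lambda' + mu),
   lambda' being lambda without its first coordinate. Coordinates >= -1 are
   preserved, and the value is 0 when lambda_1 = -1. Since
   h(0) + ... + h(m) = t^m, the recursion is solved by
     prod_k (t^(lambda_1 + ... + lambda_(k-1)) - [lambda_k = -1]).
   The partial sums start at 0 and go down by at most 1, so if one of them gets
   negative the step that takes it from 0 to -1 kills the product: this is what
   min(0, -) in the formula encodes. *)
Require Import Defs.
From mathcomp Require Import all_boot all_order all_algebra.
From mathcomp Require Import all_classical all_reals all_analysis.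
From mathcomp Require Import complex measurable_realfun ring lra zify.

Set Implicit Arguments.
Unset Strict Implicit.
Unset Printing Implicit Defensive.

Import Order.TTheory GRing.Theory Num.Theory.
Import numFieldNormedType.Exports.

Local Open Scope ring_scope.

(** * The path product and its convolution identity *)

Section PathWeight.
Variable R : comNzRingType.
Implicit Types t : R.

(* The coefficient of z^m in (1 - z) / (1 - t z). *)
Definition quot_coef t m : R := if m is m'.+1 then t ^+ m'.+1 - t ^+ m' else 1.

(* [b k] stands for [lambda_k + 1] and [p] for the partial sum reached so far.
   The truncated [.-1] is harmless: if [p + b ord0 = 0], the factor is 0. *)
Fixpoint path_weight t k p : ('I_k -> nat) -> R :=
  match k with
  | 0 => fun=> 1
  | k'.+1 => fun b => (t ^+ p - (b ord0 == 0)%:R) *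
      path_weight t (p + b ord0).-1 (fun i : 'I_k' => b (lift ord0 i))
  end.

Lemma path_weightS t k p (b : 'I_k.+1 -> nat) : path_weight t p b =
  (t ^+ p - (b ord0 == 0)%:R) *
  path_weight t (p + b ord0).-1 (fun i => b (lift ord0 i)).
Proof. by []. Qed.

(** Dividing (1 - z) / (1 - t z) by 1 - z leaves 1 / (1 - t z), whose coefficients are the powers of
    t; on coefficients this is a telescoping sum. *)
Lemma sum_quot_coef t p : \sum_(m < p.+1) quot_coef t m = t ^+ p.
Proof.
elim: p => [|p IHp]; first by rewrite big_ord1.
by rewrite big_ord_recr IHp /= addrC subrK.
Qed.

End PathWeight.

(** Used to carry one polynomial, the path weight at ['X], both into Q(t) and to its values at
    complex numbers. *)
Lemma rmorph_path_weight (R S : comNzRingType) (f : {rmorphism R -> S}) t k p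
    (b : 'I_k -> nat) :
  f (path_weight t p b) = path_weight (f t) p b.
Proof.
elim: k p b => [|k IHk] p b /=; first by rewrite rmorph1.
by rewrite rmorphM IHk rmorphB rmorphXn rmorph_nat.
Qed.

Definition ffun_cons (T : Type) k (z : T * {ffun 'I_k -> T}) :
    {ffun 'I_k.+1 -> T} :=
  [ffun i => if unlift ord0 i is Some j then z.2 j else z.1].

Lemma ffun_cons0 (T : Type) k (z : T * {ffun 'I_k -> T}) :
  ffun_cons z ord0 = z.1.
Proof. by rewrite ffunE unlift_none. Qed.

Lemma ffun_consS (T : Type) k (z : T * {ffun 'I_k -> T}) (i : 'I_k) :
  ffun_cons z (lift ord0 i) = z.2 i.
Proof. by rewrite ffunE liftK. Qed.

Lemma ffun_cons_bij (T : Type) k : bijective (@ffun_cons T k).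
Proof.
exists (fun f : {ffun 'I_k.+1 -> T} =>
  (f ord0, [ffun i => f (lift ord0 i)] : {ffun 'I_k -> T})) => [[x f]|f].
  by rewrite ffun_cons0; congr (_, _); apply/ffunP => i; rewrite ffunE ffun_consS.
apply/ffunP => i; rewrite !ffunE; case: unliftP => [j ->|->] //=.
by rewrite ffunE.
Qed.

(** This says that path weights satisfy the recursion of the Fourier coefficients. The bound [K]
    only makes the index set finite: since p < K, every f >= 0 of sum p occurs. The condition on q +
    p + sum b says that the path started at p + q ends at 0. Induction on [k], with the first value
    m of f split off. *)
Lemma path_weight_conv (R : comNzRingType) (t : R) K k p q (b : 'I_k -> nat) :
    (p < K)%N -> (q + p + \sum_i b i = k)%N ->
  \sum_(f : {ffun 'I_k -> 'I_K} | (\sum_i f i == p)%N)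
     (\prod_i quot_coef t (f i)) * path_weight t q (fun i => b i + f i)%N =
  path_weight t (p + q) b.
Proof.
elim: k p q b => [|k IHk] p q b ltpK.
  rewrite big_ord0 addn0 => /eqP; rewrite addn_eq0 => /andP[/eqP-> /eqP p0].
  rewrite (bigD1 [ffun=> Ordinal ltpK]) /=; last by rewrite big_ord0 p0.
  rewrite big_ord0 big1 ?addr0 ?mulr1 // => f /andP[_ /negP[]].
  by apply/eqP/ffunP => -[].
rewrite big_ord_recl => sum_b.
have sumE (z : 'I_K * {ffun 'I_k -> 'I_K}) :
    (\sum_i ffun_cons z i = z.1 + \sum_i z.2 i)%N.
  rewrite big_ord_recl ffun_cons0; congr addn; apply: eq_bigr => i _.
  by rewrite ffun_consS.
transitivity (\sum_(m < K) \sum_(f : {ffun 'I_k -> 'I_K} | (m + \sum_i f i == p)%N)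
    (quot_coef t m * (t ^+ q - (b ord0 + m == 0)%N%:R)) *
    ((\prod_i quot_coef t (f i)) *
       path_weight t (q + (b ord0 + m)).-1 (fun i => b (lift ord0 i) + f i)%N)).
  rewrite (reindex _ (onW_bij _ (@ffun_cons_bij _ k))) /= pair_big_dep /=.
  apply: eq_big => [z|z _]; first by rewrite sumE.
  rewrite big_ord_recl {1}ffun_cons0.
  rewrite (eq_bigr (fun i => quot_coef t (z.2 i))) => [|i _]; last first.
    by rewrite ffun_consS.
  rewrite /= ffun_cons0.
  rewrite (_ : (fun i => _) = (fun i => (b (lift ord0 i) + z.2 i)%N)); last first.
    by apply/funext => i; rewrite ffun_consS.
  by rewrite !mulrA; congr (_ * _); rewrite -!mulrA; congr (_ * _); rewrite mulrC.
rewrite [in RHS]/=.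
set P := path_weight t _ _.
transitivity (\sum_(m < K | (m < p.+1)%N)
    quot_coef t m * (t ^+ q - (b ord0 + m == 0)%N%:R) * P).
  rewrite [RHS]big_mkcond /=; apply: eq_bigr => m _.
  case: ltnP => [lemp|ltpm]; last first.
    by rewrite big_pred0 // => f; apply/negbTE; lia.
  (* If this sum is 0 the predecessor truncates and the induction hypothesis does not fit, but then
     the factor t^0 - 1 kills both sides. *)
  have [e0|ne0] := eqVneq (q + (b ord0 + m))%N 0%N.
    have -> : q = 0%N by lia.
    have -> : (b ord0 + m)%N = 0%N by lia.
    rewrite expr0 subrr mulr0 mul0r big1 // => f _; by rewrite mul0r.
  rewrite -mulr_sumr; congr (_ * _); rewrite /P.
  (* The mass p - m still to be distributed compensates the shift by m, so the inner sum does not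
     depend on m and [P] factors out. *)
  have -> : (p + q + b ord0).-1 = (p - m + (q + (b ord0 + m)).-1)%N by lia.
  rewrite -IHk; [|lia|]; last first.
    set S := (\sum_(i < k) _)%N in sum_b; set S' := (\sum_(i < k) _)%N.
    by have -> : S' = S by []; lia.
  by apply: eq_bigl => f; rewrite -[in RHS](eqn_add2l m) subnKC.
rewrite -mulr_suml; congr (_ * _).
rewrite -(big_ord_widen _ (fun m => quot_coef t m * (t ^+ q - (b ord0 + m == 0)%N%:R))) //.
under eq_bigr do rewrite mulrBr.
rewrite sumrB -mulr_suml sum_quot_coef -exprD; congr (_ - _).
(* Of the indicator terms only m = 0 survives, with coefficient 1. *)
rewrite big_ord_recl /= mul1r addn0 big1 ?addr0 // => i _.
by rewrite /bump /= addnCA mulr0.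
Qed.

(** The running total in natural numbers agrees with the integer partial sum until the latter would
    drop below 0; from there on both products are already 0. *)
Lemma path_weight_prod (F : fieldType) (t : F) k p (z : 'I_k -> int) :
    (forall i, -1 <= z i) ->
  path_weight t p (fun i => absz (z i + 1)) =
  \prod_(j < k) (t ^ (p%:Z + \sum_(i < k | (i < j)%N) z i) - (z j == -1)%:R).
Proof.
elim: k p z => [|k IHk] p z z_ge; first by rewrite big_ord0.
rewrite big_ord_recl /= big_pred0_eq addr0 -exprnP.
have -> : (absz (z ord0 + 1)%R == 0%N) = (z ord0 == -1) by rewrite absz_eq0 addr_eq0.
(* The step from 0 to -1: both sides contain the factor t^0 - 1. *)
have [e0|ne0] := eqVneq (p + absz (z ord0 + 1)%R)%N 0%N.
  have -> : p = 0%N by lia.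
  have -> : z ord0 = -1 by have := z_ge ord0; lia.
  by rewrite eqxx expr0 subrr !mul0r.
rewrite IHk => [|i]; last exact: z_ge.
congr (_ * _); apply: eq_bigr => j _; rewrite [in RHS]big_mkcond big_ord_recl /=.
rewrite -[in RHS]big_mkcond /= addrA; congr (t ^ (_ + _) - _).
by have := z_ge ord0; lia.
Qed.

(** * Heights and aggregates in terms of partial sums *)

Section Weights.
Variables (n : nat) (lambda : 'rV[int]_n.+1).

Definition partial_sum (m : nat) : int := \sum_(i < n.+1 | (i < m)%N) lambda 0 i.

Lemma partial_sumS (i : 'I_n.+1) :
  partial_sum i.+1 = partial_sum i + lambda 0 i.
Proof.
rewrite /partial_sum (bigD1 i) ?ltnSn //= addrC; congr (_ + _).
by apply: eq_bigl => j; rewrite ltnS ltn_neqAle andbC -val_eqE.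
Qed.

(** Translates aggregates, which are tail sums, into the partial sums along the path. *)
Lemma partial_sum_tail (k : 'I_n.+1) : is_weight lambda ->
  \sum_(i < n.+1 | (k <= i)%N) lambda 0 i = - partial_sum k.
Proof.
move=> /eqP lam0; apply/eqP; rewrite -addr_eq0 addrC; apply/eqP.
rewrite -[RHS]lam0 [RHS](bigID (fun i : 'I_n.+1 => (i < k)%N)) /=; congr (_ + _).
by apply: eq_bigl => i; rewrite -leqNgt.
Qed.

(** Twice the height is the sum of lambda_i - lambda_j over i < j. Grouped by j, the first terms
    give the partial sums; grouped by i, the second ones ([M]) give tail sums, which equal minus the
    partial sums in total because the coordinates add up to 0. *)
Lemma height_partial_sum : is_weight lambda ->
  height lambda = (\sum_(k < n.+1) partial_sum k)%:~R.
Proof.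
move=> wl; have /eqP lam0 := wl.
pose M := \sum_(i < n.+1) \sum_(j < n.+1 | (i < j)%N) lambda 0 j.
have LM : M = - \sum_(k < n.+1) partial_sum k.
  rewrite -[RHS]subr0 -[X in _ - X]lam0 -sumrN -sumrB; apply: eq_bigr => i _.
  rewrite -partial_sum_tail // [in RHS](bigD1 i) //= addrAC subrr add0r.
  by apply: eq_bigl => j; rewrite ltn_neqAle -val_eqE andbC eq_sym.
have -> : height lambda = 2%:R^-1 * (\sum_(k < n.+1) partial_sum k - M)%:~R.
  rewrite /height /dot /rho.
  under eq_bigr => k _ do rewrite !mxE summxE mulrCA.
  rewrite -mulr_sumr; congr (_ * _).
  under eq_bigr => k _ do rewrite mulr_sumr.
  rewrite exchange_big /= /M /partial_sum [X in (X - _)%:~R](exchange_big_dep xpredT) //=.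
  rewrite [X in (X - _)%:~R]pair_big_dep
    [X in (_ - X)%:~R]pair_big_dep /= -sumrB rmorph_sum /=.
  apply: eq_bigr => -[i j] /= _.
  under eq_bigr do rewrite !mxE eqxx /= rmorphB /= mulrBr.
  have pick (l : 'I_n.+1) :
      \sum_k (lambda 0 k)%:~R * (k == l)%:R%:~R = (lambda 0 l)%:~R :> rat.
    rewrite (bigD1 l) //= eqxx mulr1 big1 ?addr0 // => k /negPf ->.
    by rewrite mulr0.
  by rewrite sumrB !pick rmorphB.
rewrite LM opprK -mulr2n rmorphMn /=.
by rewrite -(mulr_natl _%:~R) mulKf.
Qed.

(** With s the partial sum before position k, the factor t^s - [lambda_k = -1] is t^s times either 1
    or 1 - t^(-s). The powers t^s multiply to t^height, and -s is the aggregate at k. *)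
Lemma path_weight_height (F : fieldType) (t : F) : t != 0 -> is_weight lambda ->
    (forall i, -1 <= lambda 0 i) ->
  path_weight t 0 (fun i => absz (lambda 0 i + 1)) =
  t ^ Num.floor (height lambda) *
    \prod_(j < colength lambda) (1 - t ^ Num.min 0 (aggregate j)).
Proof.
move=> t0 wl l_ge; rewrite path_weight_prod //.
have -> : Num.floor (height lambda) = \sum_(k < n.+1) partial_sum k.
  by rewrite height_partial_sum // intrKfloor.
rewrite /aggregate.
rewrite -(big_enum_val (fun i : 'I_n.+1 =>
  1 - t ^ Num.min 0 (\sum_(k < n.+1 | (i <= k)%N) lambda 0 k))) /=.
rewrite (eq_bigr (fun k : 'I_n.+1 => t ^ partial_sum k *
    (if k \in negatives lambda then 1 - t ^ (- partial_sum k) else 1))); last first.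
  move=> k _; rewrite add0r -/(partial_sum k) inE.
  have -> : (lambda 0 k == -1) = (lambda 0 k < 0) by have := l_ge k; lia.
  case: ifP => _; rewrite ?subr0 ?mulr1 //.
  by rewrite mulrBr mulr1 -expfzDr // subrr expr0z.
rewrite big_split /= -big_mkcond /=; congr (_ * _).
  elim/big_rec2: _ => [|k y x _ ->]; first by rewrite expr0z.
  by rewrite -expfzDr.
(* A negative entry preceded by a negative partial sum makes both products vanish. On the right its
   exponent is min(0, -s) = 0. *)
have [/existsP[k0 /andP[k0n k0P]]|] :=
    boolP [exists k : 'I_n.+1, (k \in negatives lambda) && (partial_sum k < 0)].
  rewrite [RHS](bigD1 k0) //= partial_sum_tail // min_l ?expr0z ?subrr ?mul0r; last by lia.
  (* On the left, the first negative partial sum is reached from 0 by an entry -1, since entries are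
     at least -1; that entry gives the factor 1 - t^0. *)
  have exP : exists m, partial_sum m < 0 by exists k0.
  case: (ex_minnP exP) => -[|m] Pm minm.
    by move: Pm; rewrite /partial_sum big_pred0_eq.
  have ltmn : (m < n.+1)%N by rewrite (leq_ltn_trans (ltnW (minm _ k0P))).
  pose k1 := Ordinal ltmn.
  have P1 : 0 <= partial_sum m.
    by rewrite leNgt; apply/negP => /minm; rewrite ltnn.
  have := partial_sumS k1; have := l_ge k1 => lk1 PS; rewrite /= in PS.
  rewrite PS in Pm.
  have e1 : partial_sum m = 0 by lia.
  rewrite (bigD1 k1) /=; last by rewrite inE; lia.
  by rewrite e1 oppr0 expr0z subrr mul0r.
rewrite negb_exists => /forallP noneg.
apply: eq_bigr => k kn; congr (1 - t ^ _); rewrite partial_sum_tail // min_r //.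
by have := noneg k; rewrite kn /=; lia.
Qed.

End Weights.

(** * Bounded measurable complex functions *)

Section BoundedMeasurable.
Context d (T : measurableType d) (R : realType).
Implicit Types (g h : T -> R) (e f : T -> R[i]).

(** A class stable under ring operations and integrable for every probability measure, so that the
    side conditions of linearity and Fubini reduce to closure properties. *)
Definition bounded_measurable g : Prop :=
  measurable_fun setT g /\ exists M : R, forall x, `|g x| <= M.

Lemma bounded_measurable_cst (r : R) : bounded_measurable (fun=> r).
Proof. by split; [exact: measurable_cst | exists `|r|]. Qed.

Lemma bounded_measurableD g h : bounded_measurable g -> bounded_measurable h ->
  bounded_measurable (fun x => g x + h x).
Proof.
move=> [mg [M gM]] [mh [N hN]]; split; first exact: measurable_funD.
by exists (M + N) => x; rewrite (le_trans (ler_normD _ _)) ?lerD.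
Qed.

Lemma bounded_measurableM g h : bounded_measurable g -> bounded_measurable h ->
  bounded_measurable (fun x => g x * h x).
Proof.
move=> [mg [M gM]] [mh [N hN]]; split; first exact: measurable_funM.
by exists (M * N) => x; rewrite normrM ler_pM.
Qed.

Lemma bounded_measurableN g : bounded_measurable g ->
  bounded_measurable (fun x => - g x).
Proof.
move=> bg; under eq_fun do rewrite -mulN1r.
exact: bounded_measurableM (bounded_measurable_cst _) bg.
Qed.

Lemma bounded_measurableV g (c : R) : bounded_measurable g -> 0 < c ->
  (forall x, c <= g x) -> bounded_measurable (fun x => (g x)^-1).
Proof.
move=> [mg _] c0 gc; have g0 x : 0 < g x by exact: lt_le_trans (gc x).
split.
  (* Measurability comes from that of the real power with exponent -1, which is inversion on
     positive reals. *)
  have -> : (fun x => (g x)^-1) = (powR (R:=R))^~ (-1) \o g.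
    by apply/funext => x /=; rewrite powR_inv1 // ltW.
  by apply: measurableT_comp => //; exact: measurable_powR.
by exists c^-1 => x; rewrite gtr0_norm ?invr_gt0 // lef_pV2 ?posrE.
Qed.

Lemma bounded_measurable_integrable (P : probability T R) g :
  bounded_measurable g -> P.-integrable setT (EFin \o g).
Proof.
move=> [mg [M gM]]; apply: measurable_bounded_integrable => //.
  by apply: le_lt_trans (probability_le1 P measurableT) _; rewrite ltry.
exists M; split; first exact: num_real.
by move=> N MN x _; exact: le_trans (gM x) (ltW MN).
Qed.

Definition cbounded_measurable f : Prop :=
  bounded_measurable (fun x => complex.Re (f x)) /\
  bounded_measurable (fun x => complex.Im (f x)).

Lemma cbounded_measurable_cst (z : R[i]) : cbounded_measurable (fun=> z).
Proof. by split; exact: bounded_measurable_cst. Qed.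

Lemma cbounded_measurableD e f : cbounded_measurable e ->
  cbounded_measurable f -> cbounded_measurable (fun x => e x + f x).
Proof.
move=> [re ie] [rf jf]; split.
  rewrite (_ : (fun x => _) = (fun x => complex.Re (e x) + complex.Re (f x))).
    exact: bounded_measurableD.
  by apply/funext => x; case: (e x) (f x) => [? ?] [? ?].
rewrite (_ : (fun x => _) = (fun x => complex.Im (e x) + complex.Im (f x))).
  exact: bounded_measurableD.
by apply/funext => x; case: (e x) (f x) => [? ?] [? ?].
Qed.

Lemma cbounded_measurableM e f : cbounded_measurable e ->
  cbounded_measurable f -> cbounded_measurable (fun x => e x * f x).
Proof.
move=> [re ie] [rf jf]; split.
  rewrite (_ : (fun x => _) = (fun x => complex.Re (e x) * complex.Re (f x)
     + - (complex.Im (e x) * complex.Im (f x)))).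
    by apply: bounded_measurableD; last apply: bounded_measurableN;
      exact: bounded_measurableM.
  by apply/funext => x; case: (e x) (f x) => [? ?] [? ?].
rewrite (_ : (fun x => _) = (fun x => complex.Re (e x) * complex.Im (f x)
     + complex.Im (e x) * complex.Re (f x))).
  by apply: bounded_measurableD; exact: bounded_measurableM.
by apply/funext => x; case: (e x) (f x) => [? ?] [? ?].
Qed.

Lemma cbounded_measurableB e f : cbounded_measurable e ->
  cbounded_measurable f -> cbounded_measurable (fun x => e x - f x).
Proof.
move=> be bf; under eq_fun do rewrite -mulN1r.
apply: cbounded_measurableD => //.
exact: cbounded_measurableM (cbounded_measurable_cst _) bf.
Qed.

(** The parts of 1/f are those of the conjugate of f divided by the squared modulus [n2], which is
    at least c^2. *)
Lemma cbounded_measurableV f (c : R) : cbounded_measurable f -> 0 < c ->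
    (forall x, c%:C%C <= `|f x|) -> cbounded_measurable (fun x => (f x)^-1).
Proof.
move=> [rf jf] c0 fc.
pose n2 x := complex.Re (f x) * complex.Re (f x) + complex.Im (f x) * complex.Im (f x).
have n2c x : c ^+ 2 <= n2 x.
  rewrite -lecR rmorphXn /= /n2 -!expr2 add_Re2_Im2.
  by rewrite ler_pXn2r ?nnegrE ?normr_ge0 // lecR ltW.
have bn2 : bounded_measurable (fun x => (n2 x)^-1).
  apply: (@bounded_measurableV _ (c ^+ 2)) => //; last by rewrite exprn_gt0.
  by apply: bounded_measurableD; exact: bounded_measurableM.
split.
  rewrite (_ : (fun x => _) = (fun x => complex.Re (f x) * (n2 x)^-1)).
    exact: bounded_measurableM.
  by apply/funext => x; rewrite /n2; case: (f x) => [a b] /=; rewrite !expr2.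
rewrite (_ : (fun x => _) = (fun x => - (complex.Im (f x) * (n2 x)^-1))).
  by apply: bounded_measurableN; exact: bounded_measurableM.
by apply/funext => x; rewrite /n2; case: (f x) => [a b] /=; rewrite !expr2.
Qed.

Lemma cbounded_measurable_sum (I : Type) (r : seq I) (Q : pred I)
    (F : I -> T -> R[i]) :
  (forall i, Q i -> cbounded_measurable (F i)) ->
  cbounded_measurable (fun x => \sum_(i <- r | Q i) F i x).
Proof.
move=> bF; elim: r => [|i r IHr].
  by under eq_fun do rewrite big_nil; exact: cbounded_measurable_cst.
under eq_fun do rewrite big_cons.
by case Qi: (Q i) => //; apply: cbounded_measurableD => //; exact: bF.
Qed.

Lemma cbounded_measurable_prod (I : Type) (r : seq I) (Q : pred I)
    (F : I -> T -> R[i]) :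
  (forall i, Q i -> cbounded_measurable (F i)) ->
  cbounded_measurable (fun x => \prod_(i <- r | Q i) F i x).
Proof.
move=> bF; elim: r => [|i r IHr].
  by under eq_fun do rewrite big_nil; exact: cbounded_measurable_cst.
under eq_fun do rewrite big_cons.
by case Qi: (Q i) => //; apply: cbounded_measurableM => //; exact: bF.
Qed.

End BoundedMeasurable.

Lemma bounded_measurable_comp d1 d2 (T1 : measurableType d1)
    (T2 : measurableType d2) (R : realType) (phi : T1 -> T2) (g : T2 -> R) :
  measurable_fun setT phi -> bounded_measurable g ->
  bounded_measurable (fun x => g (phi x)).
Proof.
move=> mphi [mg [M gM]]; split; first exact: (measurableT_comp mg mphi).
by exists M.
Qed.

Section ComplexIntegral.
Context d (T : measurableType d) (R : realType) (P : probability T R).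
Implicit Types (e f : T -> R[i]).

(** The componentwise integral of [torus_integral] over any probability space: it serves for [haar]
    and for the uniform law of one coordinate. *)
Definition cintegral f : R[i] :=
  Complex (Rintegral P setT (fun x => complex.Re (f x)))
          (Rintegral P setT (fun x => complex.Im (f x))).

Lemma cintegral_cst (z : R[i]) : cintegral (fun=> z) = z.
Proof.
case: z => a b; rewrite /cintegral /= !Rintegral_cst //.
by rewrite [X in fine X]probability_setT !mulr1.
Qed.

Lemma cintegralD e f : cbounded_measurable e -> cbounded_measurable f ->
  cintegral (fun x => e x + f x) = cintegral e + cintegral f.
Proof.
move=> [re ie] [rf jf]; rewrite /cintegral.
apply/eqP; rewrite eq_complex /=; apply/andP; split; apply/eqP.
  rewrite -RintegralD //; try exact: bounded_measurable_integrable.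
  by apply: eq_Rintegral => x _; case: (e x) (f x) => [? ?] [? ?].
rewrite -RintegralD //; try exact: bounded_measurable_integrable.
by apply: eq_Rintegral => x _; case: (e x) (f x) => [? ?] [? ?].
Qed.

Lemma cintegralZ (z : R[i]) f : cbounded_measurable f ->
  cintegral (fun x => z * f x) = z * cintegral f.
Proof.
move=> [rf jf]; rewrite /cintegral; case: z => a b.
apply/eqP; rewrite eq_complex /=; apply/andP; split; apply/eqP.
  rewrite -!RintegralZl //; try exact: bounded_measurable_integrable.
  rewrite -RintegralB //; last 2 first.
  - apply: (@bounded_measurable_integrable _ _ _ _ (fun x => a * complex.Re (f x))).
    exact: bounded_measurableM (bounded_measurable_cst _ _) rf.
  - apply: (@bounded_measurable_integrable _ _ _ _ (fun x => b * complex.Im (f x))).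
    exact: bounded_measurableM (bounded_measurable_cst _ _) jf.
  by apply: eq_Rintegral => x _; case: (f x) => [? ?].
rewrite -!RintegralZl //; try exact: bounded_measurable_integrable.
rewrite -RintegralD //; last 2 first.
- apply: (@bounded_measurable_integrable _ _ _ _ (fun x => a * complex.Im (f x))).
  exact: bounded_measurableM (bounded_measurable_cst _ _) jf.
- apply: (@bounded_measurable_integrable _ _ _ _ (fun x => b * complex.Re (f x))).
  exact: bounded_measurableM (bounded_measurable_cst _ _) rf.
by apply: eq_Rintegral => x _; case: (f x) => [? ?].
Qed.

Lemma cintegral_sum (I : Type) (r : seq I) (Q : pred I) (F : I -> T -> R[i]) :
  (forall i, Q i -> cbounded_measurable (F i)) ->
  cintegral (fun x => \sum_(i <- r | Q i) F i x) =
  \sum_(i <- r | Q i) cintegral (F i).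
Proof.
move=> bF; elim: r => [|i r IHr].
  by rewrite big_nil -[RHS](cintegral_cst 0); congr cintegral; apply/funext => x;
    rewrite big_nil.
rewrite big_cons -IHr; under eq_fun do rewrite big_cons.
case Qi: (Q i) => //; rewrite cintegralD //; first exact: bF.
exact: cbounded_measurable_sum.
Qed.

(** The factor 2 comes from bounding the real and imaginary parts separately; only geometric decay
    matters in the application. *)
Lemma norm_cintegral_le f (c : R) : cbounded_measurable f ->
  (forall x, `|f x| <= c%:C%C) -> `|cintegral f| <= (c *+ 2)%:C%C.
Proof.
move=> [rf jf] fc.
have bnd (g : T -> R) : bounded_measurable g -> (forall x, `|g x| <= c) ->
    `|Rintegral P setT g| <= c.
  move=> bg gc; have ig := @bounded_measurable_integrable _ _ _ P _ bg.
  apply: le_trans (le_normr_Rintegral _ ig) _ => //.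
  rewrite -[leRHS]mulr1 -[X in c * X](_ : fine (P setT) = 1); last first.
    by rewrite probability_setT.
  rewrite -Rintegral_cst //; apply: le_Rintegral => //.
    exact: integrable_norm.
  exact: bounded_measurable_integrable (bounded_measurable_cst _ _).
rewrite [cintegral f]complexE (le_trans (ler_normD _ _)) //.
rewrite normrM mulr2n rmorphD /= lerD //=.
  rewrite normc_def /= expr0n /= addr0 sqrtr_sqr lecR; apply: bnd => // x.
  by rewrite -lecR (le_trans _ (fc x)) // normc_ge_Re.
rewrite !normc_def /= !expr0n expr1n /= !addr0 add0r sqrtr1 mul1r sqrtr_sqr lecR.
apply: bnd => // x; rewrite -lecR (le_trans _ (fc x)) //.
rewrite normc_def lecR -sqrtr_sqr ler_sqrt ?lerDr ?sqr_ge0 //.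
by rewrite addr_ge0 ?sqr_ge0.
Qed.

Lemma cintegral_dist_le e f (c : R) : cbounded_measurable e ->
  cbounded_measurable f -> (forall x, `|e x - f x| <= c%:C%C) ->
  `|cintegral e - cintegral f| <= (c *+ 2)%:C%C.
Proof.
move=> be bf ec; have bB := cbounded_measurableB be bf.
have := norm_cintegral_le bB ec.
rewrite (_ : (fun x => _) = (fun x => e x + -1 * f x)); last first.
  by apply/funext => x; rewrite mulN1r.
rewrite cintegralD // ?cintegralZ ?mulN1r //.
exact: cbounded_measurableM (cbounded_measurable_cst _ _) bf.
Qed.

End ComplexIntegral.

(** * Integration over the torus *)

(** Fubini for extended real integrals; the inner ones are finite, so [fine] loses nothing. *)
Lemma Rintegral_prod d1 d2 (T1 : measurableType d1) (T2 : measurableType d2)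
    (R : realType) (P1 : probability T1 R) (P2 : probability T2 R)
    (g : T1 * T2 -> R) : bounded_measurable g ->
  Rintegral (P1 \x P2)%E setT g =
  Rintegral P2 setT (fun y => Rintegral P1 setT (fun x => g (x, y))).
Proof.
move=> bg; have ig := bounded_measurable_integrable (P1 \x P2)%E bg.
rewrite /Rintegral -(integral21_prod_meas1 ig); congr fine.
apply: eq_integral => y _; rewrite fineK //.
apply: integrable_fin_num => //.
apply: (@bounded_measurable_integrable _ _ _ P1 (fun x => g (x, y))).
by apply: (bounded_measurable_comp _ bg); exact: measurable_pair2.
Qed.

Section Torus.
Variable R : realType.
Let U := uniform_prob (@ltr01 R).

Lemma torus_integral_cintegral n (f : torus R n -> R[i]) :
  torus_integral f = cintegral (haar R n) f.
Proof. by []. Qed.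

(** [haar] in rank n + 1 is the image of a product measure under [torus_cons]: change of variables,
    then Fubini on each part. *)
Lemma torus_integralS n (f : torus R n.+1 -> R[i]) : cbounded_measurable f ->
  torus_integral f =
  torus_integral (fun y => cintegral U (fun x => f (torus_cons (x, y)))).
Proof.
move=> [rf jf].
have key (g : torus R n.+1 -> R) : bounded_measurable g ->
    Rintegral (haar R n.+1) setT g =
    Rintegral (haar R n) setT (fun y => Rintegral U setT (fun x => g (torus_cons (x, y)))).
  move=> bg.
  have bgc := bounded_measurable_comp (@measurable_torus_cons R n) bg.
  rewrite -(@Rintegral_prod _ _ _ _ _ U (haar R n) _ bgc).
  rewrite /Rintegral; congr fine; apply: integral_distribution.
    by apply/measurable_EFinP; case: bg.
  exact: bounded_measurable_integrable bgc.
by rewrite /torus_integral (key _ rf) (key _ jf).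
Qed.

Lemma torus_integral0 (f : torus R 0 -> R[i]) : torus_integral f = f [tuple].
Proof.
have -> : f = fun=> f [tuple] by apply/funext => x; rewrite (tuple0 x).
by rewrite torus_integral_cintegral cintegral_cst.
Qed.

Lemma expiD (x y : R) : expi (x + y) = expi x * expi y.
Proof. by apply/eqP; rewrite eq_complex /= cosD sinD addrC (addrC (sin x * _)) !eqxx. Qed.

Lemma expi0 : expi (0 : R) = 1.
Proof. by rewrite /expi cos0 sin0. Qed.

Lemma norm_expi (x : R) : `|expi x| = 1.
Proof. by rewrite normc_def /= cos2Dsin2 sqrtr1. Qed.

Lemma expi_neq0 (x : R) : expi x != 0.
Proof. by rewrite -normr_eq0 norm_expi oner_neq0. Qed.

Lemma expiN (x : R) : expi (- x) = (expi x)^-1.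
Proof.
apply: (mulfI (expi_neq0 x)).
by rewrite -expiD subrr expi0 divff // expi_neq0.
Qed.

Lemma expiMn (x : R) k : expi (x *+ k) = expi x ^+ k.
Proof.
elim: k => [|k IHk]; first by rewrite mulr0n expi0.
by rewrite mulrS expiD IHk exprS.
Qed.

Lemma expi_int (k : int) : expi (2 * pi * k%:~R) = 1 :> R[i].
Proof.
have e1 : expi (2 * pi) = 1 :> R[i].
  rewrite mulr_natl expiMn /expi cospi sinpi.
  by rewrite (_ : Complex (-1) 0 = -1) ?sqrrN ?expr1n //; simpc.
case: k => k.
  by rewrite -pmulrn mulr_natr expiMn e1 expr1n.
by rewrite NegzE rmorphN /= mulrN expiN -pmulrn mulr_natr expiMn e1 expr1n invr1.
Qed.

Lemma cbounded_measurable_expi d (T : measurableType d) (g : T -> R) :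
  measurable_fun setT g -> cbounded_measurable (fun x => expi (g x)).
Proof.
move=> mg; split; split.
- by apply: (measurableT_comp _ mg); apply: continuous_measurable_fun; exact: continuous_cos.
- by exists 1 => x /=; exact: cos_max.
- by apply: (measurableT_comp _ mg); apply: continuous_measurable_fun; exact: continuous_sin.
- by exists 1 => x /=; exact: sin_max.
Qed.


(** Nonnegativity of [g] serves to rewrite the integral for the uniform law as a Lebesgue integral
    over [0, 1]. *)
Lemma Rintegral_uniform_FTC (F g : R -> R) : continuous g ->
  (forall x : R, is_derive x (1 : R) F (g x)) -> (forall x, 0 <= g x) ->
  Rintegral U setT g = F 1 - F 0.
Proof.
move=> cg dF g0.
have cF : continuous F.
  move=> x; apply: differentiable_continuous; apply/derivable1_diffP.
  by have [] := dF x.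
rewrite /Rintegral integral_uniform //; last first.
  by apply/measurable_EFinP; exact: continuous_measurable_fun.
rewrite subr0 invr1 mul1e (@continuous_FTC2 _ g F) ?ltr01 //.
- exact: continuous_subspaceT.
- split=> [x _| |]; first by have [] := dF x.
    exact: cvg_at_right_filter (cF 0).
  exact: cvg_at_left_filter (cF 1).
- by move=> x _; rewrite derive1E; apply: derive_val.
Qed.

(** The interval [0, 1] covers a whole number of periods, so the primitives of cosine and sine take
    equal values at both ends. *)
Lemma cintegral_uniform_expi (k : int) : k != 0 ->
  cintegral U (fun x => expi (2 * pi * (k%:~R * x))) = 0.
Proof.
move=> k0; pose c : R := 2 * pi * k%:~R.
have c0 : c != 0 by rewrite !mulf_neq0 ?pnatr_eq0 ?intr_eq0 // gt_eqF // pi_gt0.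
have [ccos1 csin1] : cos c = 1 /\ sin c = 0.
  by have := expi_int k; rewrite -/c => -[].
have ccos : continuous (fun x => cos (c * x)).
  move=> x; apply: (@continuous_comp _ _ _ (fun x => c * x) cos).
    exact: mulrl_continuous.
  exact: continuous_cos.
have csin : continuous (fun x => sin (c * x)).
  move=> x; apply: (@continuous_comp _ _ _ (fun x => c * x) sin).
    exact: mulrl_continuous.
  exact: continuous_sin.
(* Cosine and sine change sign, so the fundamental theorem is applied to 1 + cos and 1 + sin, and
   the 1 is subtracted afterwards. *)
have shift (g : R -> R) : continuous g -> (forall x, `|g x| <= 1) ->
    Rintegral U setT (fun x => 1 + g x) = 1 -> Rintegral U setT g = 0.
  move=> cg g1; have bg : bounded_measurable g.
    by split; [exact: continuous_measurable_fun | exists 1].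
  have b1 := bounded_measurable_cst (measurableTypeR R) (1 : R).
  rewrite RintegralD //; try exact: bounded_measurable_integrable.
  by rewrite Rintegral_cst // [X in fine X]probability_setT mulr1 =>
    /(canRL (addKr _)) ->; rewrite addNr.
have dsin (x : R) : is_derive x (1 : R) (fun x => x + c^-1 * sin (c * x)) (1 + cos (c * x)).
  apply: is_derive_eq; rewrite /GRing.scale /= mulr1.
  by rewrite (mulrC (cos _)) mulKf.
have dcos (x : R) : is_derive x (1 : R) (fun x => x - c^-1 * cos (c * x)) (1 + sin (c * x)).
  apply: is_derive_eq; rewrite /GRing.scale /= mulr1.
  by rewrite mulNr mulrN opprK (mulrC (sin _)) mulKf.
have Icos : Rintegral U setT (fun x => cos (c * x)) = 0.
  apply: (shift _ ccos) => [x|]; first exact: cos_max.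
  rewrite (Rintegral_uniform_FTC _ dsin).
  - by rewrite mulr0 mulr1 csin1 sin0 mulr0 !addr0 subr0.
  - by move=> x; apply: continuousD; [exact: cst_continuous|exact: ccos].
  - by move=> x; rewrite -lerBlDl sub0r; have := cos_max (c * x); rewrite ler_norml => /andP[].
have Isin : Rintegral U setT (fun x => sin (c * x)) = 0.
  apply: (shift _ csin) => [x|]; first exact: sin_max.
  rewrite (Rintegral_uniform_FTC _ dcos).
  - by rewrite mulr0 mulr1 ccos1 cos0 sub0r mulr1 opprK subrK.
  - by move=> x; apply: continuousD; [exact: cst_continuous|exact: csin].
  - by move=> x; rewrite -lerBlDl sub0r; have := sin_max (c * x); rewrite ler_norml => /andP[].
under eq_fun do rewrite mulrA -/c.
by rewrite /cintegral Icos Isin.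
Qed.
End Torus.

(** * Peeling off the first coordinate *)

Section TorusCharacters.
Variable R : realType.

Lemma torus_charD n (a b : 'rV[int]_n.+1) (y : torus R n) :
  torus_char (a + b) y = torus_char a y * torus_char b y.
Proof.
rewrite /torus_char -expiD -mulrDr -big_split /=; congr (expi (_ * _)).
by apply: eq_bigr => i _; rewrite mxE rmorphD mulrDl.
Qed.

Lemma torus_char0 n (y : torus R n) : torus_char (0 : 'rV[int]_n.+1) y = 1.
Proof.
by rewrite /torus_char big1 ?mulr0 ?expi0 // => i _; rewrite mxE mul0r.
Qed.

Lemma torus_char_sum n (I : finType) (F : I -> 'rV[int]_n.+1) (y : torus R n) :
  torus_char (\sum_i F i) y = \prod_i torus_char (F i) y.
Proof.
by apply: (big_morph (fun a => torus_char a y)) => [a b|];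
  [exact: torus_charD | exact: torus_char0].
Qed.

Lemma torus_charMn n (a : 'rV[int]_n.+1) k (y : torus R n) :
  torus_char (a *+ k) y = torus_char a y ^+ k.
Proof.
elim: k => [|k IHk]; first by rewrite mulr0n torus_char0.
by rewrite mulrS torus_charD IHk exprS.
Qed.

Lemma norm_torus_char n (a : 'rV[int]_n.+1) (y : torus R n) :
  `|torus_char a y| = 1.
Proof. exact: norm_expi. Qed.

Lemma cbounded_measurable_torus_char n (a : 'rV[int]_n.+1) :
  cbounded_measurable (@torus_char R n a).
Proof.
apply: cbounded_measurable_expi.
apply: measurable_funM => //; apply: measurable_sum => i.
by apply: measurable_funM => //; exact: measurable_tnth.
Qed.

Lemma norm_one_sub_ge (t z : R[i]) : `|z| <= 1 -> 1 - `|t| <= `|1 - t * z|.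
Proof.
move=> z1; rewrite -[X in X - _](@normr1 R[i]) (le_trans _ (lerB_dist _ _)) //.
by rewrite lerD2l lerN2 normrM ler_piMr.
Qed.

(** The norm of [R[i]] has its values in [R[i]]; this provides a real number for the estimates. *)
Lemma complex_norm_real (z : R[i]) : exists2 r : R, 0 <= r & `|z| = r%:C%C.
Proof.
by exists (Num.sqrt (complex.Re z ^+ 2 + complex.Im z ^+ 2));
  rewrite ?sqrtr_ge0 // normc_def.
Qed.

(** Characters have modulus 1, so the denominator stays at distance at least 1 - |t| from 0. *)
Lemma cbounded_measurable_factor n (t : R[i]) (a : 'rV[int]_n.+1) : `|t| < 1 ->
  cbounded_measurable (fun y : torus R n =>
    (1 - torus_char a y) / (1 - t * torus_char a y)).
Proof.
move=> t1; have [r r0 tr] := complex_norm_real t.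
have r1 : 0 < 1 - r by rewrite subr_gt0 -ltcR -tr.
have bch := cbounded_measurable_torus_char a.
have b1 := cbounded_measurable_cst (torus R n) (1 : R[i]).
apply: cbounded_measurableM; first exact: cbounded_measurableB.
apply: (@cbounded_measurableV _ _ _ _ (1 - r)) => // [|y].
  apply: cbounded_measurableB => //; apply: cbounded_measurableM => //.
  exact: cbounded_measurable_cst.
rewrite rmorphB rmorph1 /= -tr; apply: norm_one_sub_ge.
by rewrite norm_torus_char.
Qed.

Lemma cbounded_measurable_C_fun n (t : R[i]) : `|t| < 1 ->
  cbounded_measurable (@C_fun R n t).
Proof.
by move=> t1; apply: cbounded_measurable_prod => r _; exact: cbounded_measurable_factor.
Qed.

End TorusCharacters.

Section Peeling.
Variable R : realType.

Definition row_tail n (lambda : 'rV[int]_n.+2) : 'rV[int]_n.+1 :=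
  \row_i lambda 0 (lift ord0 i).

(** [torus_char] does not read the last coordinate, so this makes sense for all integer vectors, in
    particular for tails of weights, whose coordinates need not add up to 0. *)
Lemma torus_char_cons n (lambda : 'rV[int]_n.+2) (x : R) (y : torus R n) :
  torus_char lambda (torus_cons (x, y)) =
  expi (2 * pi * ((lambda 0 ord0)%:~R * x)) * torus_char (row_tail lambda) y.
Proof.
rewrite /torus_char -expiD -mulrDr big_ord_recl tnth0; congr (expi (_ * (_ + _))).
  by congr ((lambda 0 _)%:~R * _); apply: val_inj.
apply: eq_bigr => i _; rewrite mxE tnthS /=; congr ((lambda 0 _)%:~R * _).
exact: val_inj.
Qed.

Lemma torus_char_root_lift n (i j : 'I_n.+1) (x : R) (y : torus R n) :
  torus_char (root_vec (lift ord0 i) (lift ord0 j)) (torus_cons (x, y)) =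
  torus_char (root_vec i j) y.
Proof.
rewrite torus_char_cons !mxE /= subrr mul0r mulr0 expi0 mul1r.
congr torus_char; apply/rowP => k; rewrite !mxE /=.
by rewrite !(inj_eq lift_inj).
Qed.

(** All roots through the first coordinate involve x by the same exponential, so integration in x
    sees only the total degree in them. *)
Lemma torus_char_root0 n (j : 'I_n.+1) (x : R) (y : torus R n) :
  torus_char (root_vec ord0 (lift ord0 j)) (torus_cons (x, y)) =
  expi (2 * pi * x) * torus_char (- eps j) y.
Proof.
rewrite torus_char_cons !mxE /= subr0 mul1r; congr (_ * _).
congr torus_char; apply/rowP => k; rewrite !mxE /=.
by rewrite !(inj_eq lift_inj) sub0r.
Qed.

Lemma C_fun_split n (t : R[i]) (theta : torus R n.+1) :
  let fac i j := (1 - torus_char (root_vec i j) theta) /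
                 (1 - t * torus_char (root_vec i j) theta) in
  C_fun t theta =
  (\prod_(j < n.+1) fac ord0 (lift ord0 j)) *
  \prod_(r : 'I_n.+1 * 'I_n.+1 | (r.1 < r.2)%N) fac (lift ord0 r.1) (lift ord0 r.2).
Proof.
move=> fac; rewrite /C_fun.
rewrite -(pair_big_dep xpredT (fun i j : 'I_n.+2 => (i < j)%N) fac) /=.
rewrite -(pair_big_dep xpredT (fun i j : 'I_n.+1 => (i < j)%N)
            (fun i j => fac (lift ord0 i) (lift ord0 j))) /=.
rewrite big_ord_recl /=; congr (_ * _).
  by rewrite big_mkcond big_ord_recl /= mul1r.
apply: eq_bigr => i _; rewrite big_mkcond big_ord_recl /= mul1r -big_mkcond /=.
by apply: eq_bigl => j; rewrite /bump /= !add1n ltnS.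
Qed.

Lemma torus_char_mono n (f : 'I_n.+1 -> nat) (y : torus R n) :
  torus_char (- \row_j (f j)%:Z) y = \prod_j torus_char (- eps j) y ^+ f j.
Proof.
under eq_bigr do rewrite -torus_charMn.
rewrite -torus_char_sum; congr torus_char; apply/rowP => k.
rewrite !mxE summxE (bigD1 k) //= big1 ?addr0 => [|j /negPf jk].
  by rewrite -scaler_nat !mxE !eqxx mulrN mulr1 natz.
by rewrite -scaler_nat !mxE eq_sym jk andbF oppr0 mulr0.
Qed.

End Peeling.

(** * Truncated series and error estimates *)

(** Writing h for [quot_coef t], one has h(m + 1) = t h(m) only from m = 1 on; hence at least two
    terms are kept. *)
Lemma quot_coef_series (R : comNzRingType) (t z : R) K :
  (1 - t * z) * \sum_(m < K.+2) quot_coef t m * z ^+ m =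
  1 - z - quot_coef t K.+2 * z ^+ K.+2.
Proof.
elim: K => [|K IHK].
  by rewrite !big_ord_recl big_ord0 /= /bump /=; ring.
by rewrite big_ord_recr mulrDr IHK /= !exprS; ring.
Qed.

(** The factors are exchanged one at a time, each exchange costing delta times k - 1 factors bounded
    by A; as 1 <= A, the power may be rounded up to k. *)
Lemma norm_prod_sub_le (F : numDomainType) k (a b : 'I_k -> F) (A delta : F) :
    1 <= A -> (forall j, `|a j| <= A) -> (forall j, `|b j| <= A) ->
    (forall j, `|a j - b j| <= delta) ->
  `|\prod_j a j - \prod_j b j| <= k%:R * A ^+ k * delta.
Proof.
move=> A1; elim: k a b => [|k IHk] a b aA bA ab.
  by rewrite !big_ord0 subrr normr0 !mul0r.
have A0 : 0 <= A by exact: le_trans A1.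
have d0 : 0 <= delta by exact: le_trans (ab ord0).
have aAk : `|\prod_(j < k) a (lift ord0 j)| <= A ^+ k.
  rewrite normr_prod -[X in A ^+ X](card_ord k) -prodr_const.
  by apply: ler_prod => j _; rewrite normr_ge0 aA.
rewrite !big_ord_recl.
set pa := \prod_(j < k) _ in aAk *; set pb := \prod_(j < k) _.
have -> : a ord0 * pa - b ord0 * pb = (a ord0 - b ord0) * pa + b ord0 * (pa - pb) by ring.
have -> : k.+1%:R * A ^+ k.+1 * delta =
    delta * A ^+ k.+1 + A * (k%:R * A ^+ k * delta) by rewrite exprS -natr1; ring.
rewrite (le_trans (ler_normD _ _)) // lerD // normrM.
  apply: ler_pM => //; rewrite (le_trans aAk) // exprS ler_peMl // exprn_ge0 //.
by apply: ler_pM => //; apply: IHk.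
Qed.

(** By [quot_coef_series] the error is exactly (t - 1) t^(K+1) z^(K+2) / (1 - t z), and |t - 1| <=
    2. *)
Lemma quot_coef_approx (R : realType) (t z : R[i]) (r : R) K :
    `|t| = r%:C%C -> r < 1 -> `|z| = 1 ->
  `|(1 - z) / (1 - t * z) - \sum_(m < K.+2) quot_coef t m * z ^+ m|
    <= (2 * r ^+ K.+1 / (1 - r))%:C%C.
Proof.
move=> tr r1 z1.
have r0 : 0 <= r by rewrite -lecR -tr normr_ge0.
have r1' : 0 < (1 - r)%:C%C by rewrite ltcR subr_gt0.
have den : (1 - r)%:C%C <= `|1 - t * z|.
  by rewrite rmorphB rmorph1 /= -tr; apply: norm_one_sub_ge; rewrite z1.
have den0 : 1 - t * z != 0 by rewrite -normr_gt0 (lt_le_trans r1').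
have -> : (1 - z) / (1 - t * z) - \sum_(m < K.+2) quot_coef t m * z ^+ m =
   quot_coef t K.+2 * z ^+ K.+2 / (1 - t * z).
  apply: (mulIf den0); rewrite mulrBl !divfK // [X in _ - X]mulrC quot_coef_series.
  by ring.
rewrite normrM normfV rmorphM fmorphV /= ler_pM ?invr_ge0 //; last first.
  by rewrite lef_pV2 ?posrE // (lt_le_trans r1').
rewrite normrM normrX z1 expr1n mulr1 /= (_ : _ - _ = (t - 1) * t ^+ K.+1); last first.
  by rewrite [t ^+ K.+2]exprS; ring.
rewrite normrM normrX tr rmorphM rmorphXn /= ler_wpM2r ?exprn_ge0 ?ler0c //.
rewrite (le_trans (ler_normB _ _)) // normr1 tr -(rmorph1 (real_complex R)).
by rewrite -rmorphD lecR; lra.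
Qed.

(** Identifies the full integral with truncated ones once these no longer depend on the order of
    truncation. *)
Lemma eq0_norm_le_geometric (R : realType) (z : R[i]) (c r : R) K0 :
  0 <= r -> r < 1 -> (forall K, (K0 <= K)%N -> `|z| <= (c * r ^+ K)%:C%C) -> z = 0.
Proof.
move=> r0 r1 zK; have [s s0 zs] := complex_norm_real z.
apply/eqP; rewrite -normr_eq0 zs; apply/eqP; congr (_ %:C)%C.
apply/eqP; rewrite eq_le s0 andbT.
have cv : (c * r ^+ K @[K --> \oo] --> c * 0)%classic.
  by apply: cvgMr; apply: cvg_expr; rewrite ger0_norm.
rewrite mulr0 in cv.
have : lim ((fun K => c * r ^+ K) @ \oo)%classic = 0 by exact: cvg_lim cv.
move=> <-; apply: limr_ge; first by apply/cvg_ex; exists 0.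
by exists K0 => // K /= K0K; rewrite -lecR -zs zK.
Qed.

Lemma cbounded_measurable_bound d (T : measurableType d) (R : realType)
    (f : T -> R[i]) : cbounded_measurable f ->
  exists2 B : R, 0 <= B & forall x, `|f x| <= B%:C%C.
Proof.
move=> [[_ [M fM]] [_ [N fN]]]; exists (`|M| + `|N|) => [|x].
  by rewrite addr_ge0.
rewrite [f x]complexE (le_trans (ler_normD _ _)) // normrM rmorphD /= lerD //.
  by rewrite normc_def /= expr0n addr0 sqrtr_sqr lecR (le_trans (fM x)) // ler_norm.
rewrite !normc_def /= !expr0n expr1n /= !addr0 add0r sqrtr1 mul1r sqrtr_sqr lecR.
by rewrite (le_trans (fN x)) // ler_norm.
Qed.

(** * Expansion and integration in the first coordinate *)

Section Peel.
Variables (R : realType) (n : nat) (t : R[i]) (lambda : 'rV[int]_n.+2).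
Hypothesis t1 : `|t| < 1.

Definition rest_fun (theta : torus R n.+1) : R[i] :=
  \prod_(r : 'I_n.+1 * 'I_n.+1 | (r.1 < r.2)%N)
    ((1 - torus_char (root_vec (lift ord0 r.1) (lift ord0 r.2)) theta) /
     (1 - t * torus_char (root_vec (lift ord0 r.1) (lift ord0 r.2)) theta)).

(* The series is truncated before applying Fubini, so that no measurability of
   the inner integral of [C_fun] is needed. *)
Definition truncated_integrand K (theta : torus R n.+1) : R[i] :=
  (\prod_(j < n.+1) \sum_(m < K) quot_coef t m *
     torus_char (root_vec ord0 (lift ord0 j)) theta ^+ m) *
  rest_fun theta * torus_char (- lambda) theta.

Lemma cbounded_measurable_rest_fun : cbounded_measurable rest_fun.
Proof. by apply: cbounded_measurable_prod => r _; exact: cbounded_measurable_factor. Qed.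

Lemma cbounded_measurable_truncated K :
  cbounded_measurable (truncated_integrand K).
Proof.
apply: cbounded_measurableM; last exact: cbounded_measurable_torus_char.
apply: cbounded_measurableM; last exact: cbounded_measurable_rest_fun.
apply: cbounded_measurable_prod => j _; apply: cbounded_measurable_sum => m _.
apply: cbounded_measurableM; first exact: cbounded_measurable_cst.
under eq_fun do rewrite -torus_charMn.
exact: cbounded_measurable_torus_char.
Qed.

(** The vector lambda' + mu of the recursion, with mu given by the exponents [f] chosen in the
    series. *)
Definition peeled K (f : {ffun 'I_n.+1 -> 'I_K}) : 'rV[int]_n.+1 :=
  row_tail lambda + \row_j (f j)%:Z.

(** Distributing the product over the truncated series leaves, for each choice [f] of exponents, a
    single exponential in x of frequency |f| - lambda_1. *)
Lemma truncated_integrand_cons K (x : R) (y : torus R n) :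
  truncated_integrand K (torus_cons (x, y)) =
  \sum_(f : {ffun 'I_n.+1 -> 'I_K})
    (\prod_j quot_coef t (f j) * (C_fun t y * torus_char (- peeled f) y)) *
    expi (2 * pi * (((\sum_j f j)%N%:Z - lambda 0 ord0)%:~R * x)).
Proof.
rewrite /truncated_integrand.
have -> : rest_fun (torus_cons (x, y)) = C_fun t y.
  by apply: eq_bigr => r _; rewrite torus_char_root_lift.
under eq_bigr do under eq_bigr do rewrite torus_char_root0.
rewrite bigA_distr_bigA -mulrA mulr_suml; apply: eq_bigr => f _.
under eq_bigr do rewrite exprMn mulrA.
rewrite !big_split /= prodrXr -expiMn -torus_char_mono torus_char_cons.
rewrite /peeled opprD torus_charD.
have -> : row_tail (- lambda) = - row_tail lambda by apply/rowP => i; rewrite !mxE.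
have -> : expi (2 * pi * (((\sum_j f j)%N%:Z - lambda 0 ord0)%:~R * x)) =
    expi (2 * pi * x *+ \sum_j f j) * expi (2 * pi * (((- lambda) 0 ord0)%:~R * x)).
  rewrite -expiD -mulr_natr pmulrn mxE; congr expi; rewrite rmorphB rmorphN /=.
  by ring.
by rewrite -!mulrA; congr (_ * _); ring.
Qed.

Lemma cintegral_uniform_expiE (k : int) :
  cintegral (uniform_prob (@ltr01 R)) (fun x => expi (2 * pi * (k%:~R * x))) =
  (k == 0)%:R.
Proof.
have [->|k0] := eqVneq k 0; last exact: cintegral_uniform_expi.
by under eq_fun do rewrite mul0r mulr0 expi0; rewrite cintegral_cst.
Qed.

(** The sum is finite, so linearity applies; integration in x keeps exactly the terms of frequency
    0. *)
Lemma torus_integral_truncated K :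
  torus_integral (truncated_integrand K) =
  \sum_(f : {ffun 'I_n.+1 -> 'I_K} | (\sum_j f j)%N%:Z == lambda 0 ord0)
    \prod_j quot_coef t (f j) * fourier_integral (peeled f) t.
Proof.
rewrite torus_integralS; last exact: cbounded_measurable_truncated.
have bG (f : {ffun 'I_n.+1 -> 'I_K}) :
    cbounded_measurable (fun y : torus R n => C_fun t y * torus_char (- peeled f) y).
  apply: cbounded_measurableM; first exact: cbounded_measurable_C_fun.
  exact: cbounded_measurable_torus_char.
have bE (c : R[i]) (k : int) : cbounded_measurable (fun x : measurableTypeR R =>
    c * expi (2 * pi * (k%:~R * x))).
  apply: cbounded_measurableM; first exact: cbounded_measurable_cst.
  under eq_fun do rewrite mulrA.
  by apply: cbounded_measurable_expi; apply: continuous_measurable_fun;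
    exact: mulrl_continuous.
transitivity (torus_integral (fun y : torus R n =>
    \sum_(f : {ffun 'I_n.+1 -> 'I_K} | (\sum_j f j)%N%:Z == lambda 0 ord0)
      \prod_j quot_coef t (f j) * (C_fun t y * torus_char (- peeled f) y))).
  congr torus_integral; apply/funext => y.
  under eq_fun do rewrite truncated_integrand_cons.
  rewrite cintegral_sum => [|f _]; last exact: bE.
  rewrite [RHS]big_mkcond; apply: eq_bigr => f _.
  rewrite cintegralZ ?cintegral_uniform_expiE ?subr_eq0; last first.
    by have := bE 1 ((\sum_j f j)%N%:Z - lambda 0 ord0); under eq_fun do rewrite mul1r.
  by case: eqP => _; rewrite ?mulr1 ?mulr0.
rewrite torus_integral_cintegral cintegral_sum => [|f _]; last first.
  by apply: cbounded_measurableM; [exact: cbounded_measurable_cst | exact: bG].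
by apply: eq_bigr => f _; rewrite cintegralZ.
Qed.

(** Up to the bounded [rest_fun] and a character of modulus 1, the two integrands are products of n
    + 1 factors that are uniformly close. *)
Lemma truncated_integrand_error : exists c r : R, [/\ 0 <= r, r < 1 &
  forall K, `|fourier_integral lambda t - torus_integral (truncated_integrand K.+2)|
    <= (c * r ^+ K.+1)%:C%C].
Proof.
have [r r0 tr] := complex_norm_real t.
have r1 : r < 1 by rewrite -ltcR -tr.
have [B B0 restB] := cbounded_measurable_bound cbounded_measurable_rest_fun.
(* An exact factor is at most 2 / (1 - r), and truncating it adds an error of at most as much
   again. *)
pose A : R := 4 / (1 - r).
(* The constant of [norm_prod_sub_le] for n + 1 factors, times the bound [B] of [rest_fun], doubled
   by [cintegral_dist_le]. *)
exists ((n.+1%:R * A ^+ n.+1 * (2 / (1 - r)) * B) *+ 2), r; split => // K.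
have r1' : 0 < 1 - r by rewrite subr_gt0.
have A1 : 1 <= A by rewrite /A ler_pdivlMr //; lra.
have bC : cbounded_measurable (fun theta : torus R n.+1 =>
    C_fun t theta * torus_char (- lambda) theta).
  apply: cbounded_measurableM; first exact: cbounded_measurable_C_fun.
  exact: cbounded_measurable_torus_char.
rewrite mulrnAl; apply: cintegral_dist_le => // [|theta].
  exact: cbounded_measurable_truncated.
rewrite C_fun_split /truncated_integrand -/(rest_fun theta) -!mulrBl.
rewrite normrM norm_torus_char mulr1 normrM.
have -> : n.+1%:R * A ^+ n.+1 * (2 / (1 - r)) * B * r ^+ K.+1 =
    (n.+1%:R * A ^+ n.+1 * (2 * r ^+ K.+1 / (1 - r))) * B by ring.
rewrite [leRHS]rmorphM ler_pM //.
pose z j := torus_char (root_vec ord0 (lift ord0 j)) theta.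
have z1 j : `|z j| = 1 by exact: norm_torus_char.
have err j := quot_coef_approx K tr r1 (z1 j).
have fa j : `|(1 - z j) / (1 - t * z j)| <= (2 / (1 - r))%:C%C.
  rewrite normrM normfV rmorphM fmorphV /= ler_pM ?invr_ge0 //.
    rewrite (le_trans (ler_normB _ _)) // normr1 z1 -(rmorph1 (real_complex R)).
    by rewrite -rmorphD lecR; lra.
  have den : (1 - r)%:C%C <= `|1 - t * z j|.
    by rewrite rmorphB rmorph1 /= -tr; apply: norm_one_sub_ge; rewrite z1.
  have r1c : 0 < (1 - r)%:C%C by rewrite ltcR.
  by rewrite lef_pV2 ?posrE // (lt_le_trans r1c).
have rK : 2 * r ^+ K.+1 / (1 - r) <= 2 / (1 - r).
  rewrite ler_wpM2r ?invr_ge0 ?(ltW r1') // ler_piMr // exprn_ile1 // ltW //.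
set delta := 2 * r ^+ K.+1 / (1 - r) in rK err *.
rewrite [leRHS]rmorphM [X in X * _]rmorphM rmorphXn rmorph_nat /=.
apply: norm_prod_sub_le => [|j|j|j].
- by rewrite -(rmorph1 (real_complex R)) lecR.
- by rewrite (le_trans (fa j)) // lecR ler_wpM2r ?invr_ge0 ?(ltW r1') //; lra.
- set S := \sum_(m < _) _; rewrite -[S](subKr ((1 - z j) / (1 - t * z j))).
  rewrite (le_trans (ler_normB _ _)) //.
  rewrite (_ : A = 2 / (1 - r) + 2 / (1 - r)); last by rewrite /A; field; rewrite gt_eqF.
  rewrite rmorphD lerD //.
  by apply: le_trans (err j) _; rewrite lecR.
- exact: err.
Qed.

End Peel.

(** * Solving the recursion *)

Lemma fourier_integral_path_weight (R : realType) n (lambda : 'rV[int]_n.+1)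
    (t : R[i]) : `|t| < 1 -> is_weight lambda -> (forall i, -1 <= lambda 0 i) ->
  fourier_integral lambda t = path_weight t 0 (fun i => absz (lambda 0 i + 1)).
Proof.
move=> t1; elim: n lambda => [|n IHn] lambda wl l_ge.
  rewrite /fourier_integral torus_integral0 /C_fun big_pred0 => [|[i j]]; last first.
    by rewrite !ord1.
  have l0 : lambda 0 ord0 = 0 by move/eqP: wl; rewrite big_ord1.
  by rewrite /torus_char big_ord0 mulr0 expi0 /= l0 expr0 subr0 !mulr1.
have sumT : lambda 0 ord0 + \sum_(i < n.+1) lambda 0 (lift ord0 i) = 0.
  by move/eqP: wl; rewrite big_ord_recl.
have [c [r [r0 r1 err]]] := truncated_integrand_error lambda t1.
apply/eqP; rewrite -subr_eq0; apply/eqP.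
(* From this order on the truncation contains all exponents up to lambda_1, so the truncated
   integral equals the path weight. The threshold is positive, which matches the error c r^(K+1) of
   K + 2 terms. *)
apply: (@eq0_norm_le_geometric _ _ c r (absz (lambda 0 ord0)).+1) => // -[//|K] ltK.
rewrite (_ : path_weight _ _ _ = torus_integral (truncated_integrand t lambda K.+2)) //.
rewrite torus_integral_truncated //.
under eq_bigr => f /eqP sumf.
  rewrite IHn; last 2 first.
  - rewrite /is_weight; under eq_bigr do rewrite !mxE.
    rewrite big_split /= addrC -(big_morph Posz PoszD (erefl 0%:Z)) sumf.
    by rewrite sumT.
  - by move=> i; rewrite !mxE; have := l_ge (lift ord0 i); lia.
  rewrite [X in path_weight t 0 X](_ : _ =
      fun i : 'I_n.+1 => (absz (lambda 0%R (lift ord0 i) + 1)%R + f i)%N); first over.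
  apply/funext => i; rewrite !mxE; move: (l_ge (lift ord0 i)).
  set u := lambda _ _; move: u (nat_of_ord (f i)) => u k u_ge; lia.
rewrite path_weightS add0n expr0.
(* No f >= 0 has sum -1, and the first factor of the path weight is 1 - 1. *)
have [l0|l0] := eqVneq (lambda 0 ord0) (-1).
  by rewrite big_pred0 => [|f]; rewrite l0 // addNr subrr mul0r.
have [p lp] : exists p : nat, lambda 0 ord0 = p%:Z.
  by exists (absz (lambda 0 ord0)); have := l_ge ord0; lia.
rewrite lp (_ : (absz (p%:Z + 1)%R == 0%N) = false) ?subr0 ?mul1r; last by lia.
rewrite (_ : (absz (p%:Z + 1)%R).-1 = (p + 0)%N); last by lia.
(* Taken with q = 0 and b_i = lambda_i + 1 on the n + 1 remaining coordinates: its condition on sums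
   is then the vanishing of the sum of all coordinates. *)
rewrite -(@path_weight_conv _ _ K.+2); last 2 first.
- by lia.
- rewrite add0n; apply/eqP; rewrite -eqz_nat PoszD -lp.
  rewrite (big_morph Posz PoszD (erefl 0%:Z)).
  have -> : \sum_(i < n.+1) (absz (lambda 0%R (lift ord0 i) + 1))%:Z =
            \sum_(i < n.+1) lambda 0 (lift ord0 i) + n.+1%:Z.
    rewrite -[n.+1 in X in _ + X]card_ord -sum1_card (big_morph Posz PoszD (erefl 0%:Z)).
    rewrite -big_split /=; apply: eq_bigr => i _.
    by have := l_ge (lift ord0 i); lia.
  by rewrite addrA sumT add0r.
by apply: eq_bigl => f; rewrite eqz_nat.
Qed.

Lemma first_layer_ge n (lambda : 'rV[int]_n.+1) : first_layer lambda ->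
  forall i, -1 <= lambda 0 i.
Proof.
case/orP => [/eqP-> i|/andP[_ /forallP]//]; by rewrite mxE.
Qed.

Theorem theorem3p5 (R : realType) (n : nat) (lambda : 'rV[int]_n.+1) :
  (1 <= n)%N -> is_weight lambda -> first_layer lambda ->
  is_fourier_coeff R lambda
    (tvar ^ Num.floor (height lambda) *
     \prod_(j < colength lambda)
        (1 - tvar ^ Num.min 0 (aggregate j)))%R.
Proof.
move=> _ wl /first_layer_ge l_ge.
have tvar0 : tvar != 0 by rewrite tofrac_eq0 polyX_eq0.
(* The coefficient is a polynomial in t, so the denominator is 1; the embedding into Q(t) and
   evaluation at t are ring morphisms and commute with the path weight. *)
exists (path_weight 'X 0 (fun i => absz (lambda 0 i + 1))), 1; split.
- exact: oner_neq0.
- by rewrite rmorph1 divr1 rmorph_path_weight path_weight_height.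
- move=> t t1 _; rewrite rmorph1 hornerC divr1 fourier_integral_path_weight //.
  rewrite rmorph_path_weight /= map_polyX.
  have := rmorph_path_weight (horner_eval t) 'X 0 (fun i => absz (lambda 0 i + 1)).
  by rewrite /= !horner_evalE hornerX => <-.
Qed.
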